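(* Let $x_0=0$, $x_1=1$, $y_0=0$, $y_{BD}=0.9$, $y_{SB}=1.1$, $y_T=2$, and let $\Omega_{\mathrm D}=(x_0,x_1)\times(y_0,y_{BD})$, $\Omega_{\mathrm B}=(x_0,x_1)\times(y_{BD},y_{SB})$, $\Omega_{\mathrm S}=(x_0,x_1)\times(y_{SB},y_T)$, with interfaces $\Gamma_{\mathrm{SB}}=\{(x,y_{SB}):x_0<x<x_1\}$ and $\Gamma_{\mathrm{BD}}=\{(x,y_{BD}):x_0<x<x_1\}$. Let the exterior data be given by functions $g_{\mathrm S}^L,g_{\mathrm S}^R:[y_{SB},y_T]\to\mathbb R^2$, $g_{\mathrm S}^T:[x_0,x_1]\to\mathbb R^2$, $g_{\mathrm B}^L,g_{\mathrm B}^R:[y_{BD},y_{SB}]\to\mathbb R^2$, $g_D^L,g_D^R:[y_0,y_{BD}]\to\mathbb R$, $g_D^B:[x_0,x_1]\to\mathbb R$, where the superscripts $L,R,T,B$ denote the left, right, top and bottom edges of the corresponding rectangle. Assume that the prescribed edge data agree at every corner of the three-rectangle partition, that is, $g_{\mathrm S}^L(y_T)=g_{\mathrm S}^T(x_0)$, $g_{\mathrm S}^R(y_T)=g_{\mathrm S}^T(x_1)$, $g_{\mathrm S}^L(y_{SB})=g_{\mathrm B}^L(y_{SB})$, $g_{\mathrm S}^R(y_{SB})=g_{\mathrm B}^R(y_{SB})$, $g_D^L(y_0)=g_D^B(x_0)$, $g_D^R(y_0)=g_D^B(x_1)$. Then for every finite parameter vector $\theta$ of the neural networks, the trial fields $u_{\mathrm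 S,\theta}$, $u_{\mathrm B,\theta}$, $q_{D,\theta}$, $p_{D,\theta}$ defined in the context satisfy: (1) the exterior conditions: $u_{\mathrm S,\theta}$ equals $g_{\mathrm S}^L$, $g_{\mathrm S}^R$, $g_{\mathrm S}^T$ on the left, right and top edges of $\Omega_{\mathrm S}$; $u_{\mathrm B,\theta}$ equals $g_{\mathrm B}^L$, $g_{\mathrm B}^R$ on the left and right edges of $\Omega_{\mathrm B}$; and $p_{D,\theta}$ equals $g_D^L$, $g_D^R$, $g_D^B$ on the left, right and bottom edges of $\Omega_{\mathrm D}$; (2) $u_{\mathrm S,\theta}=u_{\mathrm B,\theta}$ on $\Gamma_{\mathrm{SB}}$; (3) $(u_{\mathrm B,\theta})_y=(q_{D,\theta})_y$ on $\Gamma_{\mathrm{BD}}$, where the subscript $y$ denotes the second (vertical) vector component.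
   Context: Let $\mu,K_D>0$ be constants. For each finite parameter vector $\theta$, the (feedforward, $\tanh$) neural networks provide finite-valued functions: trace networks $N_{SB}:\mathbb R\to\mathbb R^2$, $N_{BD}:\mathbb R\to\mathbb R^2$, $N_{BD}^p:\mathbb R\to\mathbb R$, and raw regional outputs $\widehat u_{\mathrm S},\widehat u_{\mathrm B}:\mathbb R^2\to\mathbb R^2$, $\widehat q_{D,x},\widehat q_{D,y},\widehat p_D:\mathbb R^2\to\mathbb R$. Put $\xi=(x-x_0)/(x_1-x_0)$. The compatible traces are $$T_{SB}(x)=(1-\xi)g_{\mathrm B}^L(y_{SB})+\xi g_{\mathrm B}^R(y_{SB})+\xi(1-\xi)N_{SB}(x),$$ $$T_{BD}(x)=(1-\xi)g_{\mathrm B}^L(y_{BD})+\xi g_{\mathrm B}^R(y_{BD})+\xi(1-\xi)N_{BD}(x),$$ $$P_{BD}(x)=(1-\xi)g_D^L(y_{BD})+\xi g_D^R(y_{BD})+\xi(1-\xi)N_{BD}^p(x).$$ For a rectangle $[x_0,x_1]\times[y_b,y_t]$ with $\eta=(y-y_b)/(y_t-y_b)$ and left, right, bottom, top edge data $L(y),R(y),B(x),T(x)$ agreeing at the corners, the Coons extension is $$\mathcal C[L,R,B,T](x,y)=(1-\xi)L(y)+\xi R(y)+(1-\eta)B(x)+\eta T(x)-\big[(1-\xi)(1-\eta)c_{00}+\xi(1-\eta)c_{10}+(1-\xi)\eta c_{01}+\xi\eta c_{11}\big],$$ with $c_{00}=L(y_b)=B(x_0)$, $c_{10}=R(y_b)=B(x_1)$,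 $c_{01}=L(y_t)=T(x_0)$, $c_{11}=R(y_t)=T(x_1)$. With $\eta_{\mathrm S}=(y-y_{SB})/(y_T-y_{SB})$, $\eta_{\mathrm B}=(y-y_{BD})/(y_{SB}-y_{BD})$, $\eta_D=(y-y_0)/(y_{BD}-y_0)$ and bubbles $b_r=\xi(1-\xi)\eta_r(1-\eta_r)$ for $r\in\{\mathrm S,\mathrm B,D\}$, the trial fields on the closed rectangles are $$u_{\mathrm S,\theta}=\mathcal C[g_{\mathrm S}^L,g_{\mathrm S}^R,T_{SB},g_{\mathrm S}^T]+b_{\mathrm S}\widehat u_{\mathrm S},\qquad u_{\mathrm B,\theta}=\mathcal C[g_{\mathrm B}^L,g_{\mathrm B}^R,T_{BD},T_{SB}]+b_{\mathrm B}\widehat u_{\mathrm B},$$ $$q_{D,\theta}(x,y)=\begin{bmatrix}\widehat q_{D,x}(x,y)\\ (T_{BD}(x))_y+(y-y_{BD})\widehat q_{D,y}(x,y)\end{bmatrix},\qquad p_{D,\theta}=\mathcal C[g_D^L,g_D^R,g_D^B,P_{BD}]+\frac{\mu}{K_D}b_D\widehat p_D,$$ where each Coons extension is taken on the rectangle of the corresponding region. *)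

(* Defs.v *)
From mathcomp Require Export all_boot all_order all_algebra.
From mathcomp Require Export reals.
From mathcomp.analysis Require Export sequences exp.

Set Implicit Arguments.
Unset Strict Implicit.
Unset Printing Implicit Defensive.

Import Order.TTheory GRing.Theory Num.Theory.
Local Open Scope ring_scope.

Definition tanh (R : realType) (t : R) : R :=
  (expR t - expR (- t)) / (expR t + expR (- t)).

Fixpoint nparams (m : nat) (hidden : seq nat) (n : nat) : nat :=
  if hidden is k :: hidden' then (m * k + k + nparams k hidden' n)%N
  else (m * n + n)%N.

Definition affine_layer (R : realType) (m n : nat)
    (w : 'rV[R]_(m * n + n)) (z : 'rV[R]_m) : 'rV[R]_n :=
  z *m vec_mx (lsubmx w) + rsubmx w.

(* tanh acts entrywise on each hidden layer; the output layer is affine. *)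
Fixpoint feedforward (R : realType) (m : nat) (hidden : seq nat) (n : nat) :
    'rV[R]_(nparams m hidden n) -> 'rV[R]_m -> 'rV[R]_n :=
  match hidden
    return 'rV[R]_(nparams m hidden n) -> 'rV[R]_m -> 'rV[R]_n with
  | [::] => fun w z => affine_layer w z
  | k :: hidden' => fun w z =>
      @feedforward R k hidden' n (rsubmx w)
        (map_mx (@tanh R) (affine_layer (lsubmx w) z))
  end.

(* A fixed architecture whose weights are determined by a global parameter
   vector of length P. Since [weights] is an arbitrary map, several networks
   may share parameters: a component of a multi-output network, or a network
   preceded by a fixed affine normalisation of its input, is again a
   [tanh_network]. *)
Record tanh_network (R : realType) (P m n : nat) := TanhNetwork {
  hidden_widths : seq nat;
  weights : 'rV[R]_P -> 'rV[R]_(nparams m hidden_widths n) }.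

Definition net_eval (R : realType) (P m n : nat) (N : tanh_network R P m n)
    (theta : 'rV[R]_P) (z : 'rV[R]_m) : 'rV[R]_n :=
  feedforward (weights N theta) z.

Record networks (R : realType) (P : nat) := Networks {
  netSB : tanh_network R P 1 2;
  netBD : tanh_network R P 1 2;
  netBDp : tanh_network R P 1 1;
  netuS : tanh_network R P 2 2;
  netuB : tanh_network R P 2 2;
  netqDx : tanh_network R P 2 1;
  netqDy : tanh_network R P 2 1;
  netpD : tanh_network R P 2 1 }.

(* Edge data are total functions, of which only the values on the closed edge
   (gSL, gSR on [ySB, yT]; gBL, gBR on [yBD, ySB]; gDL, gDR on [y0, yBD];
   gST, gDB on [x0, x1]) are meaningful. *)
Record exterior_data (R : realType) := ExteriorData {
  gSL : R -> 'rV[R]_2;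
  gSR : R -> 'rV[R]_2;
  gST : R -> 'rV[R]_2;
  gBL : R -> 'rV[R]_2;
  gBR : R -> 'rV[R]_2;
  gDL : R -> R;
  gDR : R -> R;
  gDB : R -> R }.

Definition x0 {R : realType} : R := 0.
Definition x1 {R : realType} : R := 1.
Definition y0 {R : realType} : R := 0.
Definition yBD {R : realType} : R := 9 / 10.
Definition ySB {R : realType} : R := 11 / 10.
Definition yT {R : realType} : R := 2.

(* The coordinate of t relative to the interval [a, b]: xi and eta. *)
Definition rel (R : realType) (a b t : R) : R := (t - a) / (b - a).

(* The corner values are read off L and R; they equal those of B and T when
   the edge data agree at the corners. *)
Definition coons (R : realType) (V : lmodType R) (yb yt : R)
    (L Rt B T : R -> V) (x y : R) : V :=
  let xi := rel x0 x1 x in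
  let eta := rel yb yt y in
  (1 - xi) *: L y + xi *: Rt y + (1 - eta) *: B x + eta *: T x
  - (((1 - xi) * (1 - eta)) *: L yb + (xi * (1 - eta)) *: Rt yb
     + ((1 - xi) * eta) *: L yt + (xi * eta) *: Rt yt).

Definition bubble (R : realType) (yb yt x y : R) : R :=
  let xi := rel x0 x1 x in
  let eta := rel yb yt y in
  xi * (1 - xi) * (eta * (1 - eta)).

Definition point1 (R : realType) (x : R) : 'rV[R]_1 := \row_j x.
Definition point2 (R : realType) (x y : R) : 'rV[R]_2 :=
  \row_j (if j == 0 then x else y).

Definition scal (R : realType) (v : 'rV[R]_1) : R := v 0 0.

Definition vert (R : realType) (v : 'rV[R]_2) : R := v 0 1.

Section TrialFields.
Variables (R : realType) (P : nat) (mu KD : R).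
Variables (g : exterior_data R) (N : networks R P) (theta : 'rV[R]_P).

Definition compatible_trace (V : lmodType R) (a b : V) (n : R -> V)
    (x : R) : V :=
  let xi := rel x0 x1 x in
  (1 - xi) *: a + xi *: b + (xi * (1 - xi)) *: n x.

Definition TSB : R -> 'rV[R]_2 :=
  compatible_trace (gBL g ySB) (gBR g ySB)
    (fun x => net_eval (netSB N) theta (point1 x)).

Definition TBD : R -> 'rV[R]_2 :=
  compatible_trace (gBL g yBD) (gBR g yBD)
    (fun x => net_eval (netBD N) theta (point1 x)).

Definition PBD : R -> R :=
  @compatible_trace R^o (gDL g yBD) (gDR g yBD)
    (fun x => scal (net_eval (netBDp N) theta (point1 x))).

Definition uS (x y : R) : 'rV[R]_2 :=
  coons ySB yT (gSL g) (gSR g) TSB (gST g) x y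
  + bubble ySB yT x y *: net_eval (netuS N) theta (point2 x y).

Definition uB (x y : R) : 'rV[R]_2 :=
  coons yBD ySB (gBL g) (gBR g) TBD TSB x y
  + bubble yBD ySB x y *: net_eval (netuB N) theta (point2 x y).

Definition qD (x y : R) : 'rV[R]_2 :=
  point2 (scal (net_eval (netqDx N) theta (point2 x y)))
    (vert (TBD x)
     + (y - yBD) * scal (net_eval (netqDy N) theta (point2 x y))).

Definition pD (x y : R) : R :=
  @coons R R^o y0 yBD (gDL g) (gDR g) (gDB g) PBD x y
  + mu / KD * bubble y0 yBD x y
    * scal (net_eval (netpD N) theta (point2 x y)).

End TrialFields.

(* Main.v *)
(* On each edge of a rectangle the Coons extension reproduces the edge data and
   the bubble vanishes, whatever the networks return.  The compatible traces
   interpolate the corner values, so they are admissible Coons data, and the two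
   regions meeting at an interface share the same trace there. *)

Require Import Defs.
From mathcomp Require Import lra.
Import Order.TTheory GRing.Theory Num.Theory.
Local Open Scope ring_scope.

Lemma rel_left (R : realType) (a b : R) : rel a b a = 0.
Proof. by rewrite /rel subrr mul0r. Qed.

Lemma rel_right {R : realType} {a b : R} : a < b -> rel a b b = 1.
Proof. by move=> lt_ab; rewrite /rel divff // subr_eq0 gt_eqF. Qed.

Lemma x0_lt_x1 (R : realType) : x0 < x1 :> R.
Proof. exact: ltr01. Qed.

Lemma y0_lt_yBD (R : realType) : y0 < yBD :> R.
Proof. by rewrite /y0 /yBD; lra. Qed.

Lemma yBD_lt_ySB (R : realType) : yBD < ySB :> R.
Proof. by rewrite /yBD /ySB; lra. Qed.

Lemma ySB_lt_yT (R : realType) : ySB < yT :> R.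
Proof. by rewrite /ySB /yT; lra. Qed.

Section Coons.
Context {R : realType} {V : lmodType R} {yb yt : R} {L Rt B T : R -> V}.

(** At [xi = 0] the bottom and top edges contribute only their corner values, weighted by [1 - eta]
    and [eta]; corner agreement makes the subtracted bilinear term cancel them. *)
Lemma coons_left y : L yb = B x0 -> L yt = T x0 ->
  coons yb yt L Rt B T x0 y = L y.
Proof.
move=> LB LT; rewrite /coons rel_left -LB -LT subr0.
rewrite !mul1r !mul0r !scale0r !scale1r !addr0.
by rewrite -(addrA (L y)) addrK.
Qed.

Lemma coons_right y : Rt yb = B x1 -> Rt yt = T x1 ->
  coons yb yt L Rt B T x1 y = Rt y.
Proof.
move=> RB RT; rewrite /coons (rel_right (x0_lt_x1 R)) -RB -RT subrr.
rewrite !mul1r !mul0r !scale0r !scale1r !add0r !addr0.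
by rewrite -(addrA (Rt y)) addrK.
Qed.

(** The bilinear correction takes its corner values from [L] and [Rt], so at [eta = 0] it is
    literally the blend of the two vertical edges and cancels it. *)
Lemma coons_bottom x : coons yb yt L Rt B T x yb = B x.
Proof.
rewrite /coons rel_left subr0.
by rewrite !mulr1 !mulr0 !scale0r !scale1r !addr0 [_ + B x]addrC addrK.
Qed.

Lemma coons_top x : yb < yt -> coons yb yt L Rt B T x yt = T x.
Proof.
move=> lt_bt; rewrite /coons (rel_right lt_bt) subrr.
by rewrite !mulr1 !mulr0 !scale0r !scale1r !add0r !addr0 [_ + T x]addrC addrK.
Qed.

(** The factor [xi * (1 - xi)] removes the network term at both ends, for any [n]; this supplies the
    corner agreements along the interfaces. *)
Lemma compatible_trace_left (a b : V) (n : R -> V) :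
  compatible_trace a b n x0 = a.
Proof.
by rewrite /compatible_trace rel_left subr0 mul0r !scale0r scale1r !addr0.
Qed.

Lemma compatible_trace_right (a b : V) (n : R -> V) :
  compatible_trace a b n x1 = b.
Proof.
rewrite /compatible_trace (rel_right (x0_lt_x1 R)) subrr mulr0.
by rewrite !scale0r scale1r add0r addr0.
Qed.

End Coons.

Section Bubble.
Context {R : realType} {yb yt : R}.

Lemma bubble_left y : bubble yb yt x0 y = 0.
Proof. by rewrite /bubble rel_left !mul0r. Qed.

Lemma bubble_right y : bubble yb yt x1 y = 0.
Proof. by rewrite /bubble (rel_right (x0_lt_x1 R)) subrr mulr0 mul0r. Qed.

Lemma bubble_bottom x : bubble yb yt x yb = 0.
Proof. by rewrite /bubble rel_left mul0r mulr0. Qed.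

Lemma bubble_top x : yb < yt -> bubble yb yt x yt = 0.
Proof. by move=> lt_bt; rewrite /bubble (rel_right lt_bt) subrr !mulr0. Qed.

End Bubble.

Theorem proposition1 (R : realType) (mu KD : R) (mu_gt0 : 0 < mu)
    (KD_gt0 : 0 < KD) (P : nat) (N : networks R P) (g : exterior_data R)
    (cornerSTL : gSL g yT = gST g x0)
    (cornerSTR : gSR g yT = gST g x1)
    (cornerSBL : gSL g ySB = gBL g ySB)
    (cornerSBR : gSR g ySB = gBR g ySB)
    (cornerDBL : gDL g y0 = gDB g x0)
    (cornerDBR : gDR g y0 = gDB g x1) :
  forall theta : 'rV[R]_P,
  (* exterior conditions *)
  ([/\ forall y : R, ySB <= y <= yT -> uS g N theta x0 y = gSL g y,
       forall y : R, ySB <= y <= yT -> uS g N theta x1 y = gSR g y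
     & forall x : R, x0 <= x <= x1 -> uS g N theta x yT = gST g x] /\
   ((forall y : R, yBD <= y <= ySB -> uB g N theta x0 y = gBL g y) /\
    (forall y : R, yBD <= y <= ySB -> uB g N theta x1 y = gBR g y)) /\
   [/\ forall y : R, y0 <= y <= yBD -> pD mu KD g N theta x0 y = gDL g y,
       forall y : R, y0 <= y <= yBD -> pD mu KD g N theta x1 y = gDR g y
     & forall x : R, x0 <= x <= x1 -> pD mu KD g N theta x y0 = gDB g x]) /\
  (* Stokes-Brinkman interface *)
  (forall x : R, x0 < x < x1 -> uS g N theta x ySB = uB g N theta x ySB) /\
  (* Brinkman-Darcy interface *)
  (forall x : R, x0 < x < x1 ->
     vert (uB g N theta x yBD) = vert (qD g N theta x yBD)).
Proof.
move=> theta.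
have TSB0 : TSB g N theta x0 = gBL g ySB := compatible_trace_left _ _ _.
have TSB1 : TSB g N theta x1 = gBR g ySB := compatible_trace_right _ _ _.
have TBD0 : TBD g N theta x0 = gBL g yBD := compatible_trace_left _ _ _.
have TBD1 : TBD g N theta x1 = gBR g yBD := compatible_trace_right _ _ _.
(* The pressure trace is scalar, so [R] is viewed as the module [R^o] over itself. *)
have PBD0 : PBD g N theta x0 = gDL g yBD.
  exact: (@compatible_trace_left R R^o).
have PBD1 : PBD g N theta x1 = gDR g yBD.
  exact: (@compatible_trace_right R R^o).
split; [split; [split | split; [split | split]] | split].
(* The lower corner needs two facts: [TSB] ends at the Brinkman value, and [cornerSBL] identifies
   that value with the Stokes one. *)
- by move=> y _; rewrite /uS bubble_left scale0r addr0 coons_left ?TSB0.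
- by move=> y _; rewrite /uS bubble_right scale0r addr0 coons_right ?TSB1.
- move=> x _; rewrite /uS (bubble_top _ (ySB_lt_yT R)) scale0r addr0.
  exact: coons_top _ (ySB_lt_yT R).
(* Here the corner agreements are [TBD0] and [TSB0]: both traces are built from the Brinkman side
   data. *)
- by move=> y _; rewrite /uB bubble_left scale0r addr0 coons_left.
- by move=> y _; rewrite /uB bubble_right scale0r addr0 coons_right.
- by move=> y _; rewrite /pD bubble_left mulr0 mul0r addr0 coons_left.
- by move=> y _; rewrite /pD bubble_right mulr0 mul0r addr0 coons_right.
- by move=> x _; rewrite /pD bubble_bottom mulr0 mul0r addr0 coons_bottom.
- move=> x _; rewrite /uS /uB bubble_bottom (bubble_top _ (yBD_lt_ySB R)).
  by rewrite !scale0r !addr0 coons_bottom (coons_top _ (yBD_lt_ySB R)).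
- move=> x _; rewrite /uB bubble_bottom scale0r addr0 coons_bottom.
  (* At [y = yBD] the factor [y - yBD] kills the vertical flux network, leaving the vertical entry
     of [TBD x]. *)
  by rewrite /qD subrr mul0r addr0 [RHS]mxE.
Qed.
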